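(* Let $G$ be a finite simple graph and $X_0,X_1,\dots,X_{k+1}$ a nice path decomposition of $G$. The set $S$ returned by the Zero Forcing Set Algorithm (described in the context) on input $G$ and this decomposition is a zero forcing set for $G$.
   Context: Zero forcing: vertices are blue or white; a blue vertex $u$ may force a white neighbour $v$ if $v$ is the only white vertex in $N[u]$; a zero forcing set of a graph is an initial blue set from which all vertices eventually become blue. An arc set of a graph $H=(U,F)$ is a set of ordered pairs $(u,v)$ with $uv\in F$, not containing both $(u,v)$ and $(v,u)$; it is a forcing arc set if it is a collection of vertex-disjoint directed paths and there is a zero forcing process on $H$ starting from its sources (in-degree zero vertices), each white vertex forced by exactly one vertex and all vertices ending blue, such that $(u,v)$ is an arc exactly when $u$ forces $v$. $\overleftarrow{A}=\{(v,u):(u,v)\in A\}$. A nice path decomposition of $G=(V,E)$ is a sequence $X_0,\dots,X_{k+1}\subseteq V$ with (D1) every edge contained in some $X_i$, $1\le i\le k$; (D2) if $v\in X_i\cap X_j$, $i<j$, then $v\in X_s$ for $i\le s\le j$; (D3) $X_0=X_{k+1}=\emptyset$, other $X_i$ nonempty; (D4) consecutive sets differ by adding or deleting exactly one vertex; and, as for any path decomposition, every vertex of $G$ lies in some $X_i$. Notation: $X_i^j=\bigcup_{\tau=i}^jX_\tau$, $G(i,j)=G[X_i^j]$; $\mathsf{White}(S,H)$ is the set of vertices of $H$ still white when the zero forcing process on $H$ from initial blue set $S$ can no longer force; $\mathsf{FAS}(S,H)$ is a fixed (canonically chosen) forcing arc set representing the zero forcing process on $H$ from $S$ (with arcs $(u,v)$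 for each force $u\to v$); $\mathsf{Sources}(A,U)$ is the set of vertices of $U$ of in-degree zero in $(U,A)$. The Zero Forcing Set Algorithm: (L1) set $t\leftarrow0$, $S\leftarrow\emptyset$, $A\leftarrow\emptyset$, $\mathcal F\leftarrow\emptyset$. (L2) set $z\leftarrow t$, $W\leftarrow\emptyset$. (L3) while $W=\emptyset$ and $z\le k$: set $z\leftarrow z+1$ and $W\leftarrow\mathsf{White}(X_t\cup X_z,G(t,z))$. (L4) set $A\leftarrow\overleftarrow{A}$. (L5) set $S\leftarrow\mathsf{Sources}(A,X_0^t)$. (L6) if $W\ne\emptyset$: add $W$ to $\mathcal F$; set $S\leftarrow S\cup X_{z-1}$; set $A'\leftarrow A\cup\mathsf{FAS}(X_t\cup X_{z-1},G(t,z))$; set $A\leftarrow\{(u,v)\in A':v\notin X_z\}$; set $t\leftarrow z$ and go to (L2). (L7) if $W=\emptyset$: set $A\leftarrow A\cup\mathsf{FAS}(X_t,G(t,z))$. (L8) return $S$ and $\mathcal F$. *)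

(* Defs.v *)
From mathcomp Require Import all_boot.
Set Implicit Arguments.
Unset Strict Implicit.
Unset Printing Implicit Defensive.

(* A finite simple graph is a symmetric irreflexive relation [e] on a finType
   [V].  Notions about a graph H are stated for an induced subgraph G[U],
   given by its vertex set [U : {set V}]; G itself is the case U = [set: V]. *)

Section ZeroForcing.

Variables (V : finType) (e : rel V).
Implicit Types (U S B : {set V}) (A : {set V * V}) (u v : V).

Definition closed_nbhd U u : {set V} := [set w in U | (w == u) || e u w].

Definition can_force U B u v : bool :=
  [&& u \in U, u \in B, e u v & closed_nbhd U u :\: B == [set v]].

(* [p] lists, in chronological order, the forces (u, v) performed one at a time
   from the initial blue set [B]; since v must be white when it is forced, each
   vertex is forced at most once, and never when it is initially blue. *)
Fixpoint forcing_process U B (p : seq (V * V)) : bool :=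
  if p is (u, v) :: p' then can_force U B u v && forcing_process U (v |: B) p'
  else true.

Definition final_blue B (p : seq (V * V)) : {set V} :=
  B :|: [set v in unzip2 p].

Definition zero_forcing_set U S : Prop :=
  S \subset U /\
  exists2 p, forcing_process U S p & U \subset final_blue S p.

Definition force_one U B : {set V} :=
  if [pick a : V * V | can_force U B a.1 a.2] is Some a then a.2 |: B else B.

(* #|V| rounds are enough to reach a set from which no force is possible; the
   result does not depend on the forces picked, see [WhiteE]. *)
Definition White S U : {set V} := U :\: iter #|V| (force_one U) S.

Definition arc_set U A : Prop :=
  forall u v, (u, v) \in A -> [/\ u \in U, v \in U, e u v & (v, u) \notin A].

(* A directed path is the list of its vertices; its arcs are the pairs of
   consecutive vertices. *)
Definition disjoint_directed_paths U A : Prop :=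
  exists P : seq (seq V),
    [/\ uniq (flatten P), {subset flatten P <= U} &
        forall u v, (u, v) \in A <-> exists2 q, q \in P & infix [:: u; v] q].

Definition Sources A U : {set V} := [set v in U | [forall u, (u, v) \notin A]].

Definition forcing_arc_set U A : Prop :=
  [/\ arc_set U A, disjoint_directed_paths U A &
      exists p, [/\ forcing_process U (Sources A U) p,
                    U \subset final_blue (Sources A U) p &
                    A = [set a in p]]].

Definition reverse_arcs A : {set V * V} := [set (a.2, a.1) | a in A].

(* A choice of a forcing arc set FAS(S, G[U]) starting from S.  A forcing arc
   set turns all vertices blue, so one with sources S exists exactly when S is
   a zero forcing set of G[U] (see [FAS_choice_exists]); the values of [FAS] on
   other arguments are left arbitrary. *)
Definition FAS_choice (FAS : {set V} -> {set V} -> {set V * V}) : Prop :=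
  forall S U, zero_forcing_set U S ->
    forcing_arc_set U (FAS S U) /\ Sources (FAS S U) U = S.

(* Only the values X 0, ..., X k.+1 matter. *)
Definition nice_path_decomposition (k : nat) (X : nat -> {set V}) : Prop :=
  [/\ forall v, exists2 i, i <= k.+1 & v \in X i,
      forall u v, e u v ->
        exists2 i, 1 <= i <= k & (u \in X i) && (v \in X i),
      forall i j v, i < j <= k.+1 -> v \in X i -> v \in X j ->
        forall s, i <= s <= j -> v \in X s,
      [/\ X 0 = set0, X k.+1 = set0 & forall i, 1 <= i <= k -> X i != set0] &
      forall i, i <= k -> exists v,
        (v \notin X i /\ X i.+1 = v |: X i) \/
        (v \in X i /\ X i.+1 = X i :\ v)].

Section Algorithm.

Variables (k : nat) (X : nat -> {set V}).
Variable FAS : {set V} -> {set V} -> {set V * V}.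

Definition bags (i j : nat) : {set V} := \bigcup_(i <= s < j.+1) X s.

Record state := State {
  st_t : nat;
  st_S : {set V};
  st_A : {set V * V};
  st_F : {set {set V}}
}.

(* The loop "while W is empty and z <= k", where [n] bounds the number of
   rounds; k.+1 rounds are enough, as each one increments z, see
   [scan_whiteE]. *)
Fixpoint scan_white_rec (n t z : nat) (W : {set V}) : nat * {set V} :=
  if n is n'.+1 then
    if (W == set0) && (z <= k) then
      scan_white_rec n' t z.+1 (White (X t :|: X z.+1) (bags t z.+1))
    else (z, W)
  else (z, W).

Definition scan_white := scan_white_rec k.+1.

(* The body of the outer loop, from the resetting of z and W on; the returned
   boolean tells whether to go back to its beginning. *)
Definition pass (st : state) : bool * state :=
  let t := st_t st in
  let: (z, W) := scan_white t t set0 in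
  let A := reverse_arcs (st_A st) in
  let S := Sources A (bags 0 t) in
  if W != set0 then
    let F := W |: st_F st in
    let S := S :|: X z.-1 in
    let A' := A :|: FAS (X t :|: X z.-1) (bags t z) in
    let A := [set a in A' | a.2 \notin X z] in
    (true, State z S A F)
  else
    let A := A :|: FAS (X t) (bags t z) in
    (false, State t S A (st_F st)).

(* [n] bounds the number of passes; k.+2 passes are enough, as t increases at
   each repetition and never exceeds k.+1, see [run_passesE]. *)
Fixpoint run_passes_rec (n : nat) (st : state) : state :=
  if n is n'.+1 then
    let: (again, st') := pass st in
    if again then run_passes_rec n' st' else st'
  else st.

Definition run_passes := run_passes_rec k.+2.

Definition zero_forcing_algorithm : {set V} * {set {set V}} :=
  let st := run_passes (State 0 set0 set0 set0) in (st_S st, st_F st).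

Lemma scan_white_recE n m t z W : k.+1 - z <= n -> k.+1 - z <= m ->
  scan_white_rec n t z W = scan_white_rec m t z W.
Proof.
elim: n m z W => [|n IH] [|m] z W //=.
- by rewrite leqn0 subn_eq0 => ltkz _; rewrite leqNgt ltkz andbF.
- by move=> _; rewrite leqn0 subn_eq0 => ltkz; rewrite leqNgt ltkz andbF.
case: ifP => // /andP[_ lezk] le1 le2.
by apply: IH; rewrite subSS -ltnS -subSn.
Qed.

Lemma scan_whiteE t z W :
  scan_white t z W =
  if (W == set0) && (z <= k) then
    scan_white t z.+1 (White (X t :|: X z.+1) (bags t z.+1))
  else (z, W).
Proof.
rewrite /scan_white [LHS]/=; case: ifP => // _.
by apply: scan_white_recE; rewrite subSS ?leqW ?leq_subr.
Qed.

Lemma scan_white_bound n t z W : t <= z <= k.+1 -> (W != set0 -> t < z) ->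
  let: (z', W') := scan_white_rec n t z W in
  t <= z' <= k.+1 /\ (W' != set0 -> t < z').
Proof.
elim: n z W => [|n IH] z W //= /andP[letz lezk] W0.
case: ifP => [/andP[_ ltzk]|_]; last by rewrite letz lezk.
by apply: IH; rewrite ?ltzk ?(leq_trans letz) // ltnS.
Qed.

Lemma pass_again st : st_t st <= k.+1 -> (pass st).1 ->
  st_t st < st_t (pass st).2 <= k.+1.
Proof.
rewrite /pass; set t := st_t st => letk.
have := @scan_white_bound k.+1 t t set0.
rewrite leqnn letk eqxx /scan_white => /(_ isT) /(_ (fun h => ltac:(done))).
by case: (scan_white_rec _ _ _ _) => z W [/andP[_ lezk] H]; case: ifP => //= W0 _; rewrite H.
Qed.

Lemma run_passes_recE n m st : st_t st <= k.+1 ->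
  k.+1 - st_t st < n -> k.+1 - st_t st < m ->
  run_passes_rec n st = run_passes_rec m st.
Proof.
elim: n m st => [|n IH] [|m] st //= letk le1 le2.
have := pass_again letk; case: (pass st) => [[] st'] //= /(_ isT) /andP[ltt let'].
have lt : k.+1 - st_t st' < k.+1 - st_t st by rewrite ltn_sub2l // (leq_trans ltt).
by apply: IH; rewrite ?(leq_trans lt).
Qed.

Lemma run_passesE st : st_t st <= k.+1 ->
  run_passes st =
  let: (again, st') := pass st in if again then run_passes st' else st'.
Proof.
move=> letk; have := pass_again letk.
have recS n : run_passes_rec n.+1 st =
    let: (again, st') := pass st in
    if again then run_passes_rec n st' else st' by [].
rewrite /run_passes {1}recS; case: (pass st) => [[] st'] //.
case/(_ isT)/andP=> ltt let'; apply: run_passes_recE => //.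
  by rewrite ltn_subrL andbT (leq_ltn_trans _ ltt).
by rewrite ltnS leq_subr.
Qed.

End Algorithm.

Lemma force_notin U B u v : can_force U B u v -> v \in U /\ v \notin B.
Proof.
case/and4P=> _ _ _ /eqP E; have := set11 v; rewrite -E !inE.
by case/and3P=> -> ->.
Qed.

Lemma force_stuck U B0 B u v : B0 \subset B -> can_force U B0 u v ->
  (forall u' v', ~~ can_force U B u' v') -> v \in B.
Proof.
move=> sB f stuck; apply: contraT => vB; have := stuck u v.
case/and4P: f => uU uB0 euv /eqP E.
rewrite /can_force uU euv (subsetP sB _ uB0) /= => /eqP[].
apply/setP=> w; have /setP/(_ w) := E; rewrite !inE.
case: (eqVneq w v) => [->|_]; first by rewrite vB => /andP[_ ->].
case: (boolP (w \in B)) => //= wB; case: (boolP (w \in B0)) => //= wB0.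
by rewrite (subsetP sB _ wB0) in wB.
Qed.

Lemma final_blue_cons B u v p :
  final_blue B ((u, v) :: p) = final_blue (v |: B) p.
Proof. by apply/setP=> x; rewrite !inE orbCA orbA. Qed.

Lemma process_stuck U B0 B p : B0 \subset B -> forcing_process U B0 p ->
  (forall u v, ~~ can_force U B u v) -> final_blue B0 p \subset B.
Proof.
move=> + + stuck; elim: p B0 => [|[u v] p IH] B0 sB /=.
  by move=> _; apply/subsetP => x; rewrite !inE orbF; apply: (subsetP sB).
case/andP=> f /(IH (v |: B0)) H.
have vB := force_stuck sB f stuck.
rewrite final_blue_cons; apply: H.
by rewrite subUset sub1set vB.
Qed.

Lemma force_one_process U S n : exists2 p, forcing_process U S p &
  iter n (force_one U) S = final_blue S p.
Proof.
elim: n S => [|n IH] S.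
  by exists [::] => //; apply/setP=> x; rewrite !inE orbF.
rewrite iterSr {2}/force_one; case: pickP => [[u v] /= f|_]; last exact: IH.
have [p fp ->] := IH (v |: S); exists ((u, v) :: p); first by rewrite /= f.
exact/esym/final_blue_cons.
Qed.

Lemma force_one_stuck U S u v : ~~ can_force U (iter #|V| (force_one U) S) u v.
Proof.
apply/negP => f.
have grow n : n <= #|V| -> n <= #|iter n (force_one U) S|.
  elim: n => // n IH ltn; rewrite iterS; set B := iter n _ _.
  rewrite /force_one; case: pickP => [a fa|no].
    have [_ nB] := force_notin fa.
    by rewrite cardsU1 nB add1n ltnS; apply/IH/ltnW.
  have fix_ m : iter m (force_one U) B = B.
    elim: m => // m IHm; rewrite iterS IHm /force_one.
    by case: pickP => // a; rewrite no.
  move: f; rewrite -(subnK (ltnW ltn)) iterD -/B fix_ => f.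
  by have := no (u, v); rewrite /= f.
have [_] := force_notin f.
have /eqP : iter #|V| (force_one U) S == [set: V].
  by rewrite eqEcard subsetT cardsT grow.
by move=> ->; rewrite inE.
Qed.

Lemma WhiteE U S p : forcing_process U S p ->
  (forall u v, ~~ can_force U (final_blue S p) u v) ->
  White S U = U :\: final_blue S p.
Proof.
move=> fp stuck; congr (_ :\: _).
have [q fq E] := force_one_process U S #|V|.
apply/eqP; rewrite eqEsubset; apply/andP; split.
  by rewrite E; apply: process_stuck fq stuck; apply: subsetUl.
apply: process_stuck fp (@force_one_stuck U S).
by rewrite E subsetUl.
Qed.

Lemma process_arc U B p u v : forcing_process U B p -> (u, v) \in p ->
  [/\ u \in U, v \in U, e u v & v \notin B] /\
  ~~ (closed_nbhd U u \subset B).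
Proof.
elim: p B => // -[u' v'] p IH B /= /andP[f fp].
rewrite inE => /orP[/eqP[-> ->]|/(IH _ fp) [[-> -> -> vB] uB]].
  have [vU vB] := force_notin f; case/and4P: f => -> _ -> /eqP E; split=> //.
  by rewrite -setD_eq0 E; apply/set0Pn; exists v'; rewrite inE.
split; first by split=> //; apply: contra vB; rewrite inE => ->; rewrite orbT.
by apply: contra uB => /subset_trans; apply; apply: subsetUr.
Qed.

Lemma process_asym U B p u v : forcing_process U B p ->
  (u, v) \in p -> (v, u) \notin p.
Proof.
elim: p B => // -[u' v'] p IH B /= /andP[f fp].
have [v'U v'B] := force_notin f; case/and4P: (f) => _ u'B _ _.
rewrite !inE => /orP[/eqP[-> ->]|uvp]; apply/norP; split.
- by apply: contra v'B => /eqP[-> _].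
- apply/negP => /(process_arc fp) [[_ _ _]].
  by rewrite !inE u'B orbT.
- apply: contraL uvp => /eqP[-> ->]; apply/negP => /(process_arc fp) [[_ _ _]].
  by rewrite !inE u'B orbT.
- exact: IH fp uvp.
Qed.

Lemma process_paths U B p : forcing_process U B p ->
  exists P : seq (seq V), [/\ uniq (flatten P), flatten P =i final_blue B p &
    forall u v, (u, v) \in p <-> exists2 q, q \in P & infix [:: u; v] q].
Proof.
elim: p B => [|[u v] p IH] B /=.
  move=> _; exists [seq [:: x] | x <- enum B].
  have -> : flatten [seq [:: x] | x <- enum B] = enum B.
    by elim: (enum B) => //= x s ->.
  split; first exact: enum_uniq.
    by move=> x; rewrite mem_enum !inE orbF.
  by move=> u v; split=> // -[_ /mapP[x _ ->]]; rewrite infixs1 eqseq_cons andbF.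
case/andP=> f fp; have [P [uP mP aP]] := IH _ fp.
have [vU vB] := force_notin f; case/and4P: (f) => uU uB euv /eqP E.
have nbu : closed_nbhd U u \subset v |: B.
  apply/subsetP => w wN; rewrite !inE; case: (boolP (w \in B)) => [_|wB].
    exact: orbT.
  have : w \in closed_nbhd U u :\: B by rewrite inE wB.
  by rewrite E inE => ->.
have noout w : (u, w) \notin p.
  by apply/negP => /(process_arc fp) [_]; rewrite nbu.
have noin w x : x \in v |: B -> (w, x) \notin p.
  by move=> xB; apply/negP => /(process_arc fp) [[_ _ _]]; rewrite xB.
have inP x : x \in v |: B -> x \in flatten P.
  by move=> xB; rewrite mP inE xB.
have hd x q : x \in v |: B -> q \in P -> x \in q -> exists q', q = x :: q'.
  move=> xB + /splitPr xq; case: xq => q1 q2 qP.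
  case/lastP: q1 qP => [|q1 w] qP; first by exists q2.
  have /negP[] := noin w x xB; apply/aP; exists (rcons q1 w ++ x :: q2) => //.
  by rewrite cat_rcons; apply/infixP; exists q1, q2.
have uP1 : [:: u] \in P.
  have uvB : u \in v |: B by rewrite !inE uB orbT.
  have /flattenP[q qP uq] := inP _ uvB.
  have [[|w q'] Eq] := hd _ _ uvB qP uq; first by rewrite -Eq.
  have /negP[] := noout w; apply/aP; exists q => //.
  by rewrite Eq; apply/infixP; exists [::], q'.
have vvB : v \in v |: B by rewrite !inE eqxx.
have [q vqP] : exists q, v :: q \in P.
  have /flattenP[q qP vq] := inP _ vvB.
  by have [q' Eq] := hd _ _ vvB qP vq; exists q'; rewrite -Eq.
have vu : v != u by apply: contraNneq vB => ->.
pose Q := rem (v :: q) (rem [:: u] P).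
have PQ : perm_eq P ([:: u] :: (v :: q) :: Q).
  apply: perm_trans (perm_to_rem uP1) _; rewrite perm_cons.
  apply: perm_to_rem; have := vqP; rewrite (perm_mem (perm_to_rem uP1)) inE.
  by case/orP => // /eqP[/eqP]; rewrite (negPf vu).
exists ((u :: v :: q) :: Q).
have EF : perm_eq (flatten P) (flatten ((u :: v :: q) :: Q)).
  exact: perm_flatten PQ.
split.
- by rewrite -(perm_uniq EF).
- by move=> x; rewrite -(perm_mem EF) mP final_blue_cons.
move=> a b; rewrite inE; split.
  case/orP => [/eqP[-> ->]|].
    by exists (u :: v :: q); rewrite ?inE ?eqxx //; apply/infixP; exists [::], q.
  case/aP => r rP ir; move: rP; rewrite (perm_mem PQ) !inE.
  case/or3P => [/eqP Er|/eqP Er|rQ].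
  - by rewrite Er infixs1 eqseq_cons andbF in ir.
  - exists (u :: v :: q); first by rewrite inE eqxx.
    by rewrite infix_consl -Er ir orbT.
  - by exists r; rewrite // inE rQ orbT.
case=> r; rewrite inE => /orP[/eqP->|rQ ir].
  rewrite infix_consl prefix_cons => /orP[/andP[/eqP-> +]|ir].
    by rewrite prefix_cons => /andP[/eqP-> _]; rewrite eqxx.
  apply/orP; right; apply/aP; exists (v :: q) => //.
by apply/orP; right; apply/aP; exists r; rewrite // (perm_mem PQ) !inE rQ !orbT.
Qed.

Lemma process_forcing_arc_set U S p : S \subset U -> forcing_process U S p ->
  U \subset final_blue S p ->
  forcing_arc_set U [set a in p] /\ Sources [set a in p] U = S.
Proof.
move=> SU fp Up.
have ES : Sources [set a in p] U = S.
  apply/setP=> v; rewrite inE; apply/andP/idP => [[vU /forallP nv]|vS].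
    have := subsetP Up v vU; rewrite !inE => /orP[//|/mapP[[w x] wx Ev]].
    by have := nv w; rewrite inE Ev wx.
  split; first exact: subsetP SU _ vS.
  apply/forallP => u; rewrite inE; apply/negP => /(process_arc fp) [[_ _ _]].
  by rewrite vS.
split=> //; split; last by exists p; rewrite ES.
- move=> u v; rewrite !inE => uv; have [[uU vU euv _] _] := process_arc fp uv.
  by split=> //; apply: process_asym fp uv.
have [P [uP mP aP]] := process_paths fp; exists P; split=> //.
- move=> x; rewrite mP !inE => /orP[/(subsetP SU)//|/mapP[[u v] uv ->]].
  by have [[]] := process_arc fp uv.
- by move=> u v; rewrite inE; exact: aP.
Qed.

Lemma FAS_choice_exists : exists FAS, FAS_choice FAS.
Proof.
have ex S U : exists p, forcing_process U S p &&
    (iter #|V| (force_one U) S == final_blue S p).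
  by have [p fp /eqP E] := force_one_process U S #|V|; exists p; rewrite fp.
exists (fun S U => [set a in xchoose (ex S U)]) => S U [SU [p fp Up]].
have /andP[fq /eqP E] := xchooseP (ex S U).
apply: process_forcing_arc_set => //; rewrite -E.
apply: subset_trans Up _; apply: process_stuck fp _; last exact: force_one_stuck.
by rewrite E subsetUl.
Qed.

End ZeroForcing.

(* Main.v *)
Require Import Defs.
From mathcomp Require Import all_boot.
Set Implicit Arguments.
Unset Strict Implicit.
Unset Printing Implicit Defensive.

(** At the start of a pass, [A] is the set of forces of a process that turns
    [G[X_0^t]] blue and in which every vertex of [X_t] is initially blue.
    Reversing the process gives one in which the vertices of [X_t] never force.
    A vertex of [X_0^t] outside [X_t] has all its neighbours in [X_0^t], so the
    reversed process remains valid in larger graphs; once it has turned [X_0^t]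
    blue, it can be followed by any process on [G(t, z)] starting from [X_t] and
    vertices outside [X_0^t].  Making the vertices of [X_z] initially blue and
    dropping the forces into them restores the invariant at [z].  In (L6) the
    set [X_t :|: X_(z-1)] does force [G(t, z)]: adding a vertex to the bag cannot
    create white vertices, so [X_z] is obtained from [X_(z-1)] by a deletion and
    [G(t, z) = G(t, z-1)]. *)

(** * Extending and reversing zero forcing processes *)

Section Processes.

Variables (V : finType) (e : rel V).
Implicit Types (U B S T : {set V}) (p q : seq (V * V)).

Definition swap_arc (a : V * V) := (a.2, a.1).

Definition reverse_process p := rev [seq swap_arc a | a <- p].

Lemma forcing_process_cat U B p q :
  forcing_process e U B (p ++ q) =
  forcing_process e U B p && forcing_process e U (final_blue B p) q.
Proof.
elim: p B => [|[u v] p IH] B /=.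
  by congr forcing_process; apply/setP=> x; rewrite !inE orbF.
by rewrite IH final_blue_cons andbA.
Qed.

Lemma forcing_process_step U B p :
  (forall p1 a p2, p = p1 ++ a :: p2 ->
     can_force e U (final_blue B p1) a.1 a.2) ->
  forcing_process e U B p.
Proof.
elim/last_ind: p => // p [u v] IH step.
rewrite -cats1 forcing_process_cat /= andbT; apply/andP; split.
  by apply: IH => p1 a p2 Ep; apply: (step p1 a (rcons p2 (u, v))); rewrite Ep rcons_cat.
by apply: (step p (u, v) [::]); rewrite cats1.
Qed.

Lemma final_blueP B p v :
  reflect (v \in B \/ exists u, (u, v) \in p) (v \in final_blue B p).
Proof.
rewrite !inE; apply: (iffP orP) => [[->|/mapP[[u w] uw ->]]|[->|[u uv]]];
  [by left | by right; exists u | by left | right].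
by apply/mapP; exists (u, v).
Qed.

Lemma final_blueS B B' p : B \subset B' -> final_blue B p \subset final_blue B' p.
Proof. exact: setSU. Qed.

Lemma final_blue_filter B p :
  final_blue B [seq a <- p | a.2 \notin B] = final_blue B p.
Proof.
apply/setP=> v; apply/final_blueP/final_blueP => -[|[u]]; try by left.
  by rewrite mem_filter => /andP[_ uv]; right; exists u.
case: (boolP (v \in B)) => vB uv; first by left.
by right; exists u; rewrite mem_filter vB.
Qed.

(** A neighbour in [U'] of a forcing vertex either lies in [U], where it was already blue or is the
    target, or is blue from the start in [B']. So no force is blocked by a new white vertex; the
    forces whose target is already in [B'] are skipped. *)
Lemma forcing_process_extend U U' B B' p :
    U \subset U' -> B \subset B' ->
    (forall u v w, (u, v) \in p -> w \in U' -> e u w -> (w \in U) || (w \in B')) ->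
  forcing_process e U B p ->
  forcing_process e U' B' [seq a <- p | a.2 \notin B'].
Proof.
move=> sU; elim: p B B' => // -[u v] p IH B B' sB nb /= /andP[f fp].
have nb' u1 v1 w : (u1, v1) \in p -> w \in U' -> e u1 w -> (w \in U) || (w \in B').
  by move=> uv; apply: (nb u1 v1); rewrite inE uv orbT.
case: ifPn => /= vB'; last first.
  rewrite negbK in vB'; apply: (IH (v |: B)) => //.
  by rewrite subUset sub1set vB'.
apply/andP; split.
  have [vU _] := force_notin f; case/and4P: f => uU uB euv /eqP E.
  rewrite /can_force (subsetP sU _ uU) (subsetP sB _ uB) euv /=.
  apply/eqP/setP=> w; rewrite !inE; apply/idP/eqP => [|->]; last first.
    by rewrite vB' (subsetP sU _ vU) euv orbT.
  case/and3P => wB' wU' /orP[/eqP wu|euw].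
    by rewrite wu (subsetP sB _ uB) in wB'.
  have := nb u v w (mem_head _ _) wU' euw; rewrite (negPf wB') orbF => wU.
  apply/set1P; rewrite -E !inE wU euw orbT !andbT.
  by apply: contra wB' => /(subsetP sB).
(* No later force targets [v], which is blue by then, so both filters keep the same arcs. *)
have -> : [seq a <- p | a.2 \notin B'] = [seq a <- p | a.2 \notin v |: B'].
  apply: eq_in_filter => -[a b] ab; have [[_ _ _]] := process_arc fp ab.
  by rewrite !inE !negb_or => /andP[-> _].
apply: (IH (v |: B)) => //; first exact: setUS.
move=> u1 v1 w uv wU' euw; have := nb' _ _ _ uv wU' euw.
by rewrite !inE => /orP[->|->]; rewrite ?orbT.
Qed.

Lemma can_force_closed_nbhd U B u v w :
  can_force e U B u v -> w \in U -> e u w -> w \in v |: B.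
Proof.
case/and4P=> _ _ _ /eqP E wU euw; rewrite !inE.
case: (boolP (w \in B)) => [|wB]; first by rewrite orbT.
by rewrite orbF -in_set1 -E !inE wB wU euw orbT.
Qed.

Lemma mem_reverse_process p u v : ((u, v) \in reverse_process p) = ((v, u) \in p).
Proof.
rewrite mem_rev; apply/mapP/idP => [[[a b] ab [-> ->]] //|vu].
by exists (v, u).
Qed.

Lemma reverse_arcs_process p :
  reverse_arcs [set a in p] = [set a in reverse_process p].
Proof.
apply/setP=> -[u v]; rewrite !inE mem_reverse_process.
apply/imsetP/idP => [[[a b]]|vu]; first by rewrite inE => ab [-> ->].
by exists (v, u); rewrite ?inE.
Qed.

(** When [v] is about to force [u] back, exactly the forces of [p] after [(u, v)] have been undone.
    A vertex still white is then [u], or one that forced in [p] before [u] did; the latter had its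
    closed neighbourhood blue while [v] was white, so it is not in N[v]. Hence [u] is the only white
    vertex of N[v]. *)
Lemma forcing_process_rev U S p : symmetric e ->
    S \subset U -> forcing_process e U S p -> U \subset final_blue S p ->
  forcing_process e U (Sources [set a in reverse_process p] U)
    (reverse_process p).
Proof.
move=> esym SU fp Up; apply: forcing_process_step => q1 [v u] q2 /= Eq.
have [p1 Ep] : exists p1, p = p1 ++ (u, v) :: reverse_process q1.
  exists (reverse_process q2).
  rewrite -[p](_ : reverse_process (reverse_process p) = p).
    by rewrite Eq /reverse_process map_cat rev_cat /= rev_cons cat_rcons.
  by rewrite /reverse_process map_rev revK -map_comp map_id_in // => -[].
have := fp; rewrite {1}Ep forcing_process_cat /= => /and3P[fp1 f fp2].
have [vU vB] := force_notin f; case/and4P: (f) => uU uB euv _.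
have before w x : (w, x) \in p1 -> w \in final_blue S p1 /\
    forall y, y \in U -> e w y -> y \in final_blue S p1.
  move=> wx; move: fp1; case/splitPr: wx => pa pb.
  rewrite forcing_process_cat /= => /and3P[_ g _].
  have sub : x |: final_blue S pa \subset final_blue S (pa ++ (w, x) :: pb).
    apply/subsetP=> y; rewrite !inE /unzip2 map_cat mem_cat /= inE.
    by case/or3P => ->; rewrite ?orbT.
  split; first by case/and4P: g => _ wB _ _; apply: (subsetP sub); rewrite inE wB orbT.
  by move=> y yU ewy; apply: (subsetP sub); apply: can_force_closed_nbhd g yU ewy.
(* Once [u] has forced [v], its closed neighbourhood is blue and it forces nothing more in [p]; so
   [q1] contains no force into [u]. *)
have up2 w : (u, w) \notin reverse_process q1.
  apply/negP => /(process_arc fp2) [_] /negP[].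
  apply/subsetP=> y; rewrite inE => /andP[yU /orP[/eqP->|euy]].
    by rewrite inE uB orbT.
  exact: can_force_closed_nbhd f yU euy.
have white w : w \in U -> w \notin final_blue (Sources [set a in reverse_process p] U) q1 ->
    w = u \/ exists x, (w, x) \in p1.
  move=> wU wB; have : w \notin Sources [set a in reverse_process p] U.
    by apply: contra wB; rewrite [in X in _ -> X]inE => ->.
  rewrite inE wU /= => /forallPn[x]; rewrite inE negbK mem_reverse_process Ep.
  rewrite mem_cat inE => /or3P[wx|/eqP[-> _]|wx]; [by right; exists x|by left|].
  case/final_blueP: wB; right; exists x.
  by rewrite -mem_reverse_process.
apply/and4P; split=> //.
- apply: contraT => /(white v vU) [vu|[x /before[]]]; last by rewrite (negPf vB).
  by rewrite vu uB in vB.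
- by rewrite esym.
apply/eqP/setP=> w; rewrite in_setD in_set1 [w \in closed_nbhd _ _ _]inE; apply/idP/eqP => [|->].
  case/and3P => wB wU wv; have [//|[x wx]] := white w wU wB.
  have [wF nb] := before _ _ wx; case/orP: wv => [/eqP wv|evw].
    by rewrite -wv wF in vB.
  by case/negP: vB; apply: nb; rewrite // esym.
rewrite uU esym euv orbT !andbT; apply/negP => /final_blueP[|[x]].
  rewrite inE => /andP[_ /forallP/(_ v)]; rewrite inE mem_reverse_process Ep.
  by rewrite mem_cat inE eqxx orbT.
by rewrite -mem_reverse_process; apply/negP.
Qed.

Lemma final_blue_Sources U p :
  U \subset final_blue (Sources [set a in p] U) p.
Proof.
apply/subsetP=> v vU; apply/final_blueP.
case: (boolP (v \in Sources [set a in p] U)) => [|nv]; first by left.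
right; move: nv; rewrite inE vU /= => /forallPn[u]; rewrite inE negbK => uv.
by exists u.
Qed.

(** The process that computes [White] ends stuck, and a stuck blue set containing [S] contains
    everything that any process from [S] turns blue. This translates the test of the inner loop. *)
Lemma zero_forcing_setP U S :
  S \subset U -> zero_forcing_set e U S <-> White e S U = set0.
Proof.
move=> SU; have [q fq E] := force_one_process e U S #|V|.
split=> [[_ [p fp Up]]|/eqP]; last first.
  by rewrite setD_eq0 => UW; split=> //; exists q; rewrite -?E.
apply/eqP; rewrite setD_eq0; apply: subset_trans Up _.
by apply: process_stuck fp (@force_one_stuck _ _ _ _); rewrite E subsetUl.
Qed.

End Processes.

(** * Bags as separators, and the effect of one pass *)

Section Invariant.

Variables (V : finType) (e : rel V) (k : nat) (X : nat -> {set V}).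
Variable FAS : {set V} -> {set V} -> {set V * V}.
Hypotheses (e_sym : symmetric e) (X_nice : nice_path_decomposition e k X).
Hypothesis FAS_ok : FAS_choice e FAS.

Lemma bagsP i j v : reflect (exists2 s, i <= s <= j & v \in X s) (v \in bags X i j).
Proof.
rewrite /bags (big_morph (fun B : {set V} => v \in B) (in_setU v) (in_set0 v)) big_has.
apply: (iffP hasP) => -[s]; first by rewrite mem_index_iota => H; exists s.
by move=> H vs; exists s; rewrite ?mem_index_iota.
Qed.

Lemma sub_bags i j s : i <= s <= j -> X s \subset bags X i j.
Proof. by move=> H; apply/subsetP=> v vs; apply/bagsP; exists s. Qed.

Lemma bags_sub i j i' j' : i' <= i -> j <= j' -> bags X i j \subset bags X i' j'.
Proof.
move=> lei lej; apply/subsetP=> v /bagsP[s /andP[l1 l2] vs]; apply/bagsP; exists s => //.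
by rewrite (leq_trans lei l1) (leq_trans l2 lej).
Qed.

Lemma bags_cat i t j : i <= t <= j -> bags X i j = bags X i t :|: bags X t j.
Proof.
case/andP=> leit letj; apply/eqP; rewrite eqEsubset subUset !bags_sub // !andbT.
apply/subsetP=> v /bagsP[s /andP[l1 l2] vs]; rewrite inE.
by case: (leqP s t) => [lst|/ltnW lts]; apply/orP; [left|right]; apply/bagsP; exists s;
  rewrite ?l1 ?l2 ?lts.
Qed.

Lemma bagsS i j : i <= j -> bags X i j.+1 = bags X i j :|: X j.+1.
Proof. by move=> leij; rewrite /bags big_nat_recr //= ltnW // ltnS. Qed.

Lemma bags0T : bags X 0 k.+1 = [set: V].
Proof.
have [cov _ _ _ _] := X_nice.
by apply/setP=> v; rewrite inE; apply/bagsP; have [i lei vi] := cov v; exists i.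
Qed.

(** The bags containing [v] have consecutive indices, and there is one on each side of [t]. *)
Lemma bags_cap t z v : z <= k.+1 ->
  v \in bags X 0 t -> v \in bags X t z -> v \in X t.
Proof.
have [_ _ conv _ _] := X_nice.
move=> lez /bagsP[s /= lest vs] /bagsP[s' /andP[lets' les'z] vs'].
have := leq_trans lest lets'; rewrite leq_eqVlt => /orP[/eqP ss'|lt].
  by have -> : t = s by apply/eqP; rewrite eqn_leq lest ss' lets'.
by apply: (conv s s') => //; rewrite ?lt ?lest ?(leq_trans les'z).
Qed.

(** A bag containing both ends of the edge cannot have index above [t]: consecutiveness would put
    [u] in [X t]. *)
Lemma bags_nbhd t u w :
  u \in bags X 0 t -> u \notin X t -> e u w -> w \in bags X 0 t.
Proof.
have [_ edge conv _ _] := X_nice.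
move=> /bagsP[s /= lest us] ut /edge[i /andP[_ leik] /andP[ui wi]].
case: (leqP i t) => [leit|ltti]; first by apply/bagsP; exists i.
case/negP: ut; apply: (conv s i) => //; last by rewrite lest ltnW.
by rewrite (leq_ltn_trans lest ltti) leqW.
Qed.

(** The blue set is existential rather than [st_S]: a pass reads only [t] and [A], and recomputes
    [st_S] from the reversed arcs. *)
Definition pass_invariant (t : nat) (A : {set V * V}) : Prop :=
  exists (S : {set V}) p, [/\ X t \subset S, S \subset bags X 0 t,
    forcing_process e (bags X 0 t) S p, bags X 0 t \subset final_blue S p &
    A = [set a in p]].

(** Serves both kinds of pass: [Y] is [X z.-1] when the algorithm goes on, and empty in the last
    pass. The reversed process first turns [bags X 0 t] blue, so only the part of [Y] outside it has
    to be in [S']. *)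
Lemma pass_process t z A Y r (S' : {set V}) : t <= z <= k.+1 -> pass_invariant t A ->
    forcing_process e (bags X t z) (X t :|: Y) r ->
    bags X t z \subset final_blue (X t :|: Y) r ->
    Sources (reverse_arcs A) (bags X 0 t) :|: (Y :\: bags X 0 t) \subset S' ->
  exists p, [/\ forcing_process e (bags X 0 z) S' p,
    bags X 0 z \subset final_blue S' p &
    [set a in p] =
    [set a in reverse_arcs A :|: [set a in r] | a.2 \notin S']].
Proof.
case/andP=> letz lezk [S [p [XS SU fp Up ->]]] fr Ur.
rewrite reverse_arcs_process; set q := reverse_process p.
set U := bags X 0 t; set T := Sources _ U; rewrite subUset => /andP[TS' YS'].
have fq : forcing_process e U T q by apply: forcing_process_rev fp Up.
have Uq : U \subset final_blue T q by apply: final_blue_Sources.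
have Uq' : U \subset final_blue S' q by apply: subset_trans Uq (final_blueS _ TS').
have sUz : U \subset bags X 0 z by apply: bags_sub.
pose q' := [seq a <- q | a.2 \notin S'].
have fq' : forcing_process e (bags X 0 z) S' q'.
  apply: forcing_process_extend fq => // u v w.
  rewrite mem_reverse_process => vu _ euw; apply/orP; left.
  have [[_ uU _ uS] _] := process_arc fp vu.
  by apply: bags_nbhd uU _ euw; apply: contra uS => /(subsetP XS).
have Eq' : final_blue S' q' = final_blue S' q by apply: final_blue_filter.
set B := final_blue S' q in Eq' Uq'.
have sB : X t :|: Y \subset B.
  rewrite subUset; apply/andP; split.
    by apply: subset_trans Uq'; apply: sub_bags; rewrite /= leqnn.
  apply/subsetP=> y yY; case: (boolP (y \in U)) => [/(subsetP Uq')//|yU].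
  by rewrite inE (subsetP YS') // inE yU.
exists (q' ++ [seq a <- r | a.2 \notin B]); split.
- rewrite forcing_process_cat fq' Eq' /=; apply: forcing_process_extend fr => //.
    exact: bags_sub.
  move=> u v w _; rewrite (@bags_cat 0 t z) // inE orbC => + _.
  by case/orP => [->//|/(subsetP Uq')->]; rewrite orbT.
- have -> : final_blue S' (q' ++ [seq a <- r | a.2 \notin B]) = final_blue B r.
    by rewrite -(final_blue_filter B r) -Eq'; apply/setP=> x; rewrite !inE /unzip2 map_cat mem_cat orbA.
  rewrite (@bags_cat 0 t z) // subUset; apply/andP; split.
    by apply: subset_trans Uq' _; apply: subsetUl.
  exact: subset_trans Ur (final_blueS _ sB).
apply/setP=> -[u v]; rewrite !inE mem_cat !mem_filter andb_orl /=.
congr (_ || _); first exact: andbC.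
rewrite [RHS]andbC; apply/andP/andP => -[vB uv]; split=> //.
  by apply: contra vB; rewrite [in X in _ -> X]inE => ->.
(* An arc of [r] into a vertex forced by [q] would end in both [bags X 0 t] and [bags X t z], hence
   in [X t], which is blue when [r] starts. *)
apply: contra vB => /final_blueP[//|[w]]; rewrite mem_reverse_process => vw.
have [[vU _ _ _] _] := process_arc fp vw.
have [[_ vz _]] := process_arc fr uv; rewrite inE.
by rewrite (bags_cap lezk vU vz).
Qed.

Lemma FAS_process U S : zero_forcing_set e U S ->
  exists r, [/\ forcing_process e U S r, U \subset final_blue S r &
    FAS S U = [set a in r]].
Proof. by move=> /FAS_ok[[_ _ [r [fr Ur E]]] ES]; rewrite ES in fr Ur; exists r. Qed.

Lemma pass_invariant_step t z A : t < z <= k.+1 -> X z \subset X z.-1 ->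
    zero_forcing_set e (bags X t z) (X t :|: X z.-1) -> pass_invariant t A ->
  pass_invariant z [set a in reverse_arcs A :|: FAS (X t :|: X z.-1) (bags X t z)
                   | a.2 \notin X z].
Proof.
case/andP=> lttz lezk sX zf inv; have letz := ltnW lttz.
have [r [fr Ur ->]] := FAS_process zf.
set U := bags X 0 t; set T := Sources (reverse_arcs A) U; set Y := X z.-1 in sX fr Ur *.
have TU : T \subset U by apply/subsetP=> x; rewrite inE => /andP[].
(* The first two parts are what [pass_process] demands; [X z] is added to restore the invariant at
   [z]. *)
have [||p [fp Up Ep]] := @pass_process t z A Y r (T :|: (Y :\: U) :|: X z) _ inv fr Ur.
- by rewrite letz.
- exact: subsetUl.
exists (T :|: (Y :\: U) :|: X z), p; split=> //; first exact: subsetUr.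
  rewrite !subUset (subset_trans TU) ?bags_sub //= sub_bags ?leqnn // andbT.
  by apply: subset_trans (subsetDl _ _) _; rewrite sub_bags ?leq_pred.
(* The algorithm drops only the arcs into [X z]. This is the same set, as no arc enters [T] or
   [Y :\: U]: reversed arcs end at non-sources in [U], and arcs of [r] end outside [Y] and outside
   [X t], hence outside [U]. *)
rewrite Ep; apply/setP=> -[u v]; rewrite [LHS]inE [RHS]inE /=.
case: (boolP (_ \in _)) => //= uv; congr (~~ _); rewrite [RHS]inE [X in _ = X || _]inE.
case: (v \in X z); rewrite ?orbT // orbF; apply/esym/norP.
move: uv; rewrite inE => /orP[uvA|].
  case: inv => S0 [p0 [_ _ fp0 _ EA]]; move: (uvA); rewrite EA reverse_arcs_process inE.
  rewrite mem_reverse_process => /(process_arc fp0)[[vU _ _ _] _].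
  split; last by rewrite inE vU.
  by rewrite inE; apply/nandP; right; apply/forallPn; exists u; rewrite negbK.
rewrite inE => /(process_arc fr)[[_ vz _ vB] _]; move: vB; rewrite inE => /norP[vt vY].
split; last by rewrite inE (negPf vY) andbF.
by apply: contra vt => /(subsetP TU) vU; apply: bags_cap vU vz.
Qed.

(** * The inner and outer loops *)

Lemma zero_forcing_bags_add t z : t <= z -> X z \subset X z.+1 ->
    zero_forcing_set e (bags X t z) (X t :|: X z) ->
  zero_forcing_set e (bags X t z.+1) (X t :|: X z.+1).
Proof.
move=> letz sX [_ [p fp Up]]; have letz1 := leqW letz.
have sB : X t :|: X z \subset X t :|: X z.+1 by apply: setUS.
split; first by rewrite subUset !sub_bags ?leqnn ?letz1.
(* Any vertex new to the graph lies in [X z.+1] and is blue from the start, so it hinders no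
   force. *)
exists [seq a <- p | a.2 \notin X t :|: X z.+1].
  apply: forcing_process_extend fp => //; first exact: bags_sub.
  by move=> u v w _; rewrite bagsS // !inE => /orP[->|->] //; rewrite !orbT.
rewrite final_blue_filter bagsS // subUset (subset_trans Up) ?final_blueS //=.
by apply: subset_trans (subsetUl _ _); apply: subsetUr.
Qed.

(** The loop invariant is that [X t :|: X z] forces [bags X t z]; it persists while the white set
    stays empty. The bound on [n] ensures that running out of rounds means [z = k.+1]. *)
Lemma scan_white_rec_spec n t z : t <= z -> z <= k.+1 -> k.+1 - z <= n ->
    zero_forcing_set e (bags X t z) (X t :|: X z) ->
  let: (y, W) := scan_white_rec e k X n t z set0 in
  if W == set0 then y = k.+1 /\ zero_forcing_set e (bags X t y) (X t :|: X y)
  else [/\ t < y <= k.+1, X y \subset X y.-1 &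
           zero_forcing_set e (bags X t y) (X t :|: X y.-1)].
Proof.
elim: n z => [|n IH] z letz lezk /=.
  rewrite leqn0 subn_eq0 eqxx => ltkz zf; split=> //.
  by apply/eqP; rewrite eqn_leq lezk.
rewrite eqxx /=; case: (leqP z k) => [lezk' len zf|ltkz _ zf]; last first.
  by rewrite eqxx; split=> //; apply/eqP; rewrite eqn_leq lezk.
have sB : X t :|: X z.+1 \subset bags X t z.+1.
  by rewrite subUset !sub_bags ?leqnn ?(leqW letz).
have Wstop : White e (X t :|: X z.+1) (bags X t z.+1) != set0 ->
    scan_white_rec e k X n t z.+1 (White e (X t :|: X z.+1) (bags X t z.+1)) =
    (z.+1, White e (X t :|: X z.+1) (bags X t z.+1)).
  by move=> /negPf W0; case: n {IH len} => //= n; rewrite W0.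
case: (eqVneq (White e (X t :|: X z.+1) (bags X t z.+1)) set0) => [W0|W0]; last first.
  rewrite Wstop // (negPf W0) /= ltnS letz ltnS lezk'.
  (* An added vertex would leave no white vertex, so a vertex was deleted; the graph is then
     unchanged and the invariant at [z] still applies to it. *)
  have [_ _ _ _ /(_ z lezk') [v]] := X_nice; case=> -[vz Ez].
    case/eqP: W0; apply/zero_forcing_setP => //.
    by apply: zero_forcing_bags_add zf => //; rewrite Ez subsetUr.
  have sX : X z.+1 \subset X z by rewrite Ez subsetDl.
  split=> //; suff -> : bags X t z.+1 = bags X t z by [].
  by rewrite bagsS //; apply/setUidPl/(subset_trans sX)/sub_bags; rewrite letz leqnn.
rewrite W0; apply: IH => //; first exact: leqW.
  by rewrite subSS -ltnS -subSn.
exact/zero_forcing_setP.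
Qed.

Lemma scan_white_spec t : t <= k.+1 ->
  let: (y, W) := scan_white e k X t t set0 in
  if W == set0 then y = k.+1 /\ zero_forcing_set e (bags X t y) (X t :|: X y)
  else [/\ t < y <= k.+1, X y \subset X y.-1 &
           zero_forcing_set e (bags X t y) (X t :|: X y.-1)].
Proof.
move=> letk; apply: scan_white_rec_spec => //; first exact: leq_subr.
rewrite setUid /bags big_nat1; split=> //; exists [::] => //.
exact: subsetUl.
Qed.

Lemma run_passes_zero_forcing st :
    st_t st <= k.+1 -> pass_invariant (st_t st) (st_A st) ->
  zero_forcing_set e [set: V] (st_S (run_passes e k X FAS st)).
Proof.
have [n] := ubnP (k.+1 - st_t st); elim: n st => // n IH st; rewrite ltnS => len letk inv.
rewrite run_passesE //; have := scan_white_spec letk; rewrite /pass.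
case: scan_white => z W; case: ifP => /= [_ [-> zf]|_ [ltz sX zf]].
  (* In the last pass [X k.+1] is empty, so [X t] alone forces the rest, and the sources of the
     reversed arcs suffice as initial set. *)
  have [_ _ _ [_ Xk _] _] := X_nice; rewrite Xk in zf.
  case: zf => _ [r fr Ur]; split; first exact: subsetT.
  have [||p [fp Up _]] := @pass_process _ k.+1 _ set0 r
    (Sources (reverse_arcs (st_A st)) (bags X 0 (st_t st))) _ inv fr Ur.
  - by rewrite letk leqnn.
  - by rewrite set0D setU0.
  by rewrite bags0T in fp Up; exists p.
have /andP[ltt lezk] := ltz; apply: IH => //=; last exact: pass_invariant_step.
by apply: leq_trans len; rewrite ltn_sub2l // (leq_trans ltt).
Qed.

End Invariant.

Theorem theorem4p8 (V : finType) (e : rel V)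
    (e_sym : symmetric e) (e_irr : irreflexive e)
    (k : nat) (X : nat -> {set V}) (X_nice : nice_path_decomposition e k X)
    (FAS : {set V} -> {set V} -> {set V * V}) (FAS_ok : FAS_choice e FAS) :
  zero_forcing_set e [set: V] (zero_forcing_algorithm e k X FAS).1.
Proof.
apply: run_passes_zero_forcing => //=.
have [_ _ _ [X0 _ _] _] := X_nice.
(* Initially [t = 0] and [X 0] is empty, so the empty process on the empty graph gives the
   invariant. *)
exists set0, [::]; split; rewrite /bags ?big_nat1 ?X0 ?sub0set //.
Qed.
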